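(* Let $T$ be a tree of order $n>5$, and let $D_n$ denote the tree consisting of two adjacent vertices $x,y$, where $x$ has $\lceil (n-2)/2\rceil$ further neighbours of degree $1$ and $y$ has $\lfloor (n-2)/2\rfloor$ further neighbours of degree $1$ (so its degree sequence is $(\lceil n/2\rceil,\lfloor n/2\rfloor,1,\dots,1)$). Then $$\eta(T)+\eta(\overline{T})\leq \eta(D_n)+\eta(\overline{D_n})=5\cdot 2^{n-2}-2^{\lceil (n-2)/2\rceil}-2^{\lfloor (n-2)/2\rfloor}+n,$$ with equality if and only if $T$ is isomorphic to $D_n$.
   Context: $\overline{X}$ is the complement of a graph $X$. $\eta(X)$ is the number of nonempty vertex subsets $S\subseteq V(X)$ such that the induced subgraph on $S$ is connected. (In the paper, $D_n$ is denoted $H^{\lfloor (n-2)/2\rfloor}_{\lceil (n-2)/2\rceil}$, where $H^{t-1}_{s-1}$ is the tree with degree sequence $(s,t,1,\dots,1)$.) *)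

(* Defs.v *)
From mathcomp Require Import all_boot.

Set Implicit Arguments.
Unset Strict Implicit.
Unset Printing Implicit Defensive.

Record sgraph := SGraph {
  vertex :> finType;
  adj : rel vertex;
  adj_sym : symmetric adj;
  adj_irr : irreflexive adj
}.

Section Graph.
Variable G : sgraph.

Definition compl_adj : rel G := [rel x y | (x != y) && ~~ adj x y].

Lemma compl_adj_sym : symmetric compl_adj.
Proof. by move=> x y; rewrite /compl_adj /= eq_sym adj_sym. Qed.

Lemma compl_adj_irr : irreflexive compl_adj.
Proof. by move=> x; rewrite /compl_adj /= eqxx. Qed.

Definition compl : sgraph := SGraph compl_adj_sym compl_adj_irr.

Definition induced_adj (S : {set G}) : rel {x : G | x \in S} :=
  [rel u v | adj (val u) (val v)].

Lemma induced_adj_sym S : symmetric (@induced_adj S).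
Proof. by move=> u v; rewrite /induced_adj /= adj_sym. Qed.

Lemma induced_adj_irr S : irreflexive (@induced_adj S).
Proof. by move=> u; rewrite /induced_adj /= adj_irr. Qed.

Definition induced (S : {set G}) : sgraph :=
  SGraph (@induced_adj_sym S) (@induced_adj_irr S).

End Graph.

(* The graph with no vertex counts as connected here; [is_tree] and [eta]
   exclude it explicitly. *)
Definition connected (G : sgraph) : bool :=
  [forall x : G, forall y : G, connect (@adj G) x y].

(* Cycles have at least three vertices: a single edge xy gives the
   duplicate-free closed walk [:: x; y], which is not a cycle of the graph. *)
Definition acyclic (G : sgraph) : Prop :=
  forall c : seq G, 2 < size c -> ~ ucycle (@adj G) c.

Definition is_tree (G : sgraph) : Prop :=
  [/\ 0 < #|G|, connected G & acyclic G].

Definition isomorphic (G H : sgraph) : Prop :=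
  exists2 f : G -> H,
    bijective f & forall x y : G, adj (f x) (f y) = adj x y.

Definition eta (G : sgraph) : nat :=
  #|[set S : {set G} | (S != set0) && connected (induced S)]|.

Section DoubleStar.
Variables s t : nat.

(* [inl None] and [inr None] are the two centres x and y; [inl (Some i)] are
   the s leaves at x and [inr (Some j)] the t leaves at y. *)
Definition dstar_adj : rel (option 'I_s + option 'I_t)%type := fun u v =>
  match u, v with
  | inl None, inr None | inr None, inl None => true
  | inl None, inl (Some _) | inl (Some _), inl None => true
  | inr None, inr (Some _) | inr (Some _), inr None => true
  | _, _ => false
  end.

Lemma dstar_adj_sym : symmetric dstar_adj.
Proof. by case=> [[i|]|[i|]] [[j|]|[j|]]. Qed.

Lemma dstar_adj_irr : irreflexive dstar_adj.
Proof. by case=> [[i|]|[i|]]. Qed.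

Definition dstar : sgraph := SGraph dstar_adj_sym dstar_adj_irr.

End DoubleStar.

(* [uphalf] is the rounded-up half, [_./2] the rounded-down half. *)
Definition D (n : nat) : sgraph := dstar (uphalf (n - 2)) (n - 2)./2.

(* Main.v *)
(* For every vertex set S, the subgraph induced on S or the one induced by the
   complement graph is connected.  Hence eta G + eta (compl G) is
   2 ^ n - 1 + n + M(G), where M(G) counts the sets with at least two elements
   that are connected in both graphs; in a tree these are the subtrees of
   diameter at least 3.  The bound M(A) <= (2 ^ s - 1) * (2 ^ t - 1), with s and
   t the two halves of #|A| - 2, is proved by induction on a connected set A.
   Take a longest path v, u, p, ..., z', z in A.  With at most four vertices, A
   is a double star with centres u and p and M(A) is computed exactly.
   Otherwise delete v: all the neighbours of u but p are leaves, so a counted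
   set through v contains v, u, p, is not {v, u, p}, and contains z' if it
   contains z.  There are at most 3 * 2 ^ (#|A| - 5) - 1 such sets, less than
   the increment of the bound as soon as #|A| > 5. *)
Require Import Defs.
From mathcomp Require Import all_boot.
From mathcomp Require Import zify.

Set Implicit Arguments.
Unset Strict Implicit.
Unset Printing Implicit Defensive.

(** * Connectivity of induced subgraphs, in a graph and in its complement *)

(** Connectivity by cuts keeps all reasoning in [G], away from paths in the subtype of [S]. For the
    converse, [B] is the component of [x]. *)
Lemma connected_inducedP (G : sgraph) (S : {set G}) :
  reflect (forall B : {set G},
             {in S &, forall a b, adj a b -> a \in B -> b \in B} ->
             {in S &, forall x y, x \in B -> y \in B})
          (connected (induced S)).
Proof.
apply: (iffP idP) => [/forallP conS B clB x y xS yS xB | cutS].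
  have /forallP/(_ (exist _ y yS))/connectP[s pth lst] := conS (exist _ x xS).
  rewrite -[y]/(val (exist (fun z => z \in S) y yS)) lst.
  rewrite -[x]/(val (exist (fun z => z \in S) x xS)) in xB.
  elim: s (exist _ x xS) xB pth {lst} => [|w s IHs] //= z zB /andP[zw pth].
  by apply: IHs pth; apply: (clB _ _ (valP z) (valP w) zw zB).
apply/forallP => x; apply/forallP => y.
pose B := [set val z | z : induced S & connect (@adj (induced S)) x z].
have clB : {in S &, forall a b, adj a b -> a \in B -> b \in B}.
  move=> a b aS bS ab /imsetP[z]; rewrite inE => xz az.
  apply/imsetP; exists (exist _ b bS) => //; rewrite inE.
  by apply: connect_trans xz (connect1 _); rewrite /= /induced_adj /= -az.
have xB : val x \in B by apply/imsetP; exists x; rewrite ?inE ?connect0.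
have /imsetP[z] := cutS B clB _ _ (valP x) (valP y) xB.
by rewrite inE => xz /val_inj->.
Qed.

Lemma connected_induced_hub (G : sgraph) (S : {set G}) (h : G) :
  (forall B : {set G}, {in S &, forall a b, adj a b -> (a \in B) = (b \in B)} ->
     {in S, forall x, (x \in B) = (h \in B)}) ->
  connected (induced S).
Proof.
move=> hub; apply/connected_inducedP => B clB x y xS yS.
suff eqB : {in S &, forall a b, adj a b -> (a \in B) = (b \in B)}.
  by rewrite !(hub B eqB).
by move=> a b aS bS ab; apply/idP/idP; apply: clB; rewrite // adj_sym.
Qed.

Lemma adj_complE (G : sgraph) (x y : G) :
  @adj (compl G) x y = (x != y) && ~~ adj x y.
Proof. by []. Qed.

(** If [C] is closed in the complement and separates [x] from [y] within [S], then every pair across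
    [C] is an edge of [G]. These edges form a complete bipartite graph with both sides nonempty, so
    they connect [S]. *)
Lemma connected_or_compl (G : sgraph) (S : {set G}) :
  connected (induced S) || connected (@induced (compl G) S).
Proof.
case: (boolP (connected (induced S))) => //= ncS.
apply/connected_inducedP => C clC x y xS yS xC; apply: contraNT ncS => yC.
have cross : {in S &, forall a b, a \in C -> b \notin C -> @adj G a b}.
  move=> a b aS bS aC bC; apply: contraNT (bC) => nab.
  apply: (clC a b) => //; rewrite adj_complE nab andbT.
  by apply: contraNneq bC => <-.
apply: (@connected_induced_hub G S x) => B eqB.
have outB b : b \in S -> b \notin C -> (b \in B) = (x \in B).
  by move=> bS bC; rewrite (eqB x b) // cross.
move=> a aS; have [aC|] := boolP (a \in C); last exact: outB.
by rewrite -(outB y) // (eqB a y) // cross.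
Qed.

(** * Sets connected in both graphs *)

Definition conn_coconn (G : sgraph) (S : {set G}) : bool :=
  [&& 1 < #|S|, connected (induced S) & connected (@induced (compl G) S)].

Definition nb_conn_coconn (G : sgraph) (A : {set G}) : nat :=
  #|[set S : {set G} | (S \subset A) && conn_coconn S]|.

(** Inclusion-exclusion: the union of the two families is all nonempty sets; their intersection
    consists of the singletons and the sets counted by [nb_conn_coconn]. *)
Lemma eta_add_compl (G : sgraph) :
  eta G + eta (compl G) = 2 ^ #|G| - 1 + #|G| + nb_conn_coconn [set: G].
Proof.
pose X := [set S : {set G} | (S != set0) && connected (induced S)].
pose Y := [set S : {set G} | (S != set0) && connected (@induced (compl G) S)].
rewrite -[eta G]/#|X| -[eta (compl G)]/#|Y| -cardsUI.
have -> : X :|: Y = powerset [set: G] :\ set0.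
  apply/setP => S; rewrite !inE subsetT andbT.
  by have [->|_] //= := eqVneq S set0; apply: connected_or_compl.
rewrite cardsDS ?sub1set ?inE ?sub0set // card_powerset cards1 cardsT -addnA; congr (_ + _).
have -> : X :&: Y = [set [set x] | x : G] :|:
    [set S : {set G} | (S \subset [set: G]) && conn_coconn S].
  apply/setP => S; rewrite !inE subsetT /=.
  have [->|S0] /= := eqVneq S set0.
    rewrite /conn_coconn cards0 orbF; apply/esym/negbTE/imsetP => -[x _ E].
    by have := set11 x; rewrite -E inE.
  have [/imsetP[x _ ->]|nsing] /= := boolP (S \in _).
    apply/andP; split; apply/connected_inducedP => B _ a b;
    by rewrite !inE => /eqP-> /eqP->.
  rewrite /conn_coconn ltn_neqAle card_gt0 S0 andbT eq_sym.
  suff -> : #|S| != 1 by [].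
  by apply: contra nsing => /cards1P[x ->]; apply: imset_f.
rewrite cardsU disjoint_setI0 ?cards0 ?subn0.
  by rewrite card_imset //; apply: set1_inj.
apply/pred0P => S /=; rewrite !inE; apply/negbTE/andP => -[/imsetP[x _ ->]].
by rewrite /conn_coconn cards1 andbF.
Qed.

(** Connectivity in [G] forces the centre [u] into [S]; but [u] is isolated in the complement, so
    connectivity there leaves only [u]. *)
Lemma star_not_conn_coconn (G : sgraph) (S : {set G}) (u : G) :
  {in S, forall x, x != u -> adj u x} ->
  {in S &, forall x t, x != u -> adj x t -> t = u} -> ~~ conn_coconn S.
Proof.
move=> domu leafu; apply/and3P => -[/card_gt1P[x [y [xS yS xy]]]].
move=> /connected_inducedP conS /connected_inducedP coS.
have uS : u \in S.
  apply/negPn/negP => uNS; case/eqP: xy; apply/esym/set1P.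
  apply: (conS [set x]) (set11 x) => // a b aS bS ab /set1P ax.
  have aNu : a != u by apply: contraNneq uNS => <-.
  by rewrite -(leafu a b aS bS aNu ab) bS in uNS.
have allu z : z \in S -> z = u.
  move=> zS; apply/set1P; apply: (coS [set u]) (set11 u) => // a b _ bS.
  rewrite adj_complE => /andP[ab nab] /set1P au; move: ab nab.
  by rewrite {a}au eq_sym => bu /negP[]; apply: domu.
by rewrite (allu x) // (allu y) // eqxx in xy.
Qed.

Section Pendant.
Variables (G : sgraph) (S : {set G}) (v u : G).
Hypotheses (pendant : {in S, forall t, adj v t -> t = u}).

(** Without [u], the vertex [v] would be isolated in [S], which has a second element. *)
Lemma pendant_neighbour : conn_coconn S -> v \in S -> u \in S.
Proof.
move=> /and3P[+ /connected_inducedP conS _] vS.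
rewrite (cardsD1 v) vS => /card_gt0P[y]; rewrite !inE => /andP[yv yS].
apply/negPn/negP => uNS; case/negP: yv; apply/eqP/set1P.
apply: (conS [set v]) (set11 v) => // a b _ bS ab /set1P av.
by rewrite {}av in ab; rewrite -(pendant bS ab) bS in uNS.
Qed.

End Pendant.

(** * Double stars and their exact count *)

Definition outer (G : sgraph) (A : {set G}) (u p : G) : {set G} :=
  [set x in A | adj u x & x != p].

(* [outer A u p] and [outer A p u] may be empty, so stars are double stars. *)
Definition double_star (G : sgraph) (A : {set G}) (u p : G) : Prop :=
  [/\ [/\ u \in A, p \in A & adj u p],
      {in outer A u p & A, forall w t, adj w t -> t = u},
      {in outer A p u & A, forall w t, adj w t -> t = p}
    & A \subset [set u; p] :|: (outer A u p :|: outer A p u)].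

Lemma double_starC (G : sgraph) (A : {set G}) (u p : G) :
  double_star A u p -> double_star A p u.
Proof.
by case=> -[uA pA up] lu lp sA; split; rewrite 1?adj_sym // setUC
  [outer A p u :|: _]setUC setUC [[set p; u]]setUC.
Qed.

(** If [S] misses the leaves at [p], then [p] itself can only be a leaf at [u], and [S] falls under
    [star_not_conn_coconn]. *)
Lemma conn_coconn_meets_outer (G : sgraph) (A S : {set G}) (u p : G) :
  double_star A u p -> S \subset A -> conn_coconn S ->
  S :&: outer A p u != set0.
Proof.
case=> -[_ _ up] lu _ sA sSA; apply: contraTneq => S0.
have inS x : x \in S -> x != u -> (x == p) || (x \in outer A u p).
  move=> xS xu; have /(subsetP sA) := subsetP sSA x xS.
  rewrite !in_setU !in_set1 (negbTE xu) /= => /or3P[->|->|xQ] //.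
    by rewrite orbT.
  by have := in_set0 x; rewrite -S0 in_setI xS xQ.
apply: (@star_not_conn_coconn _ _ u) => [x xS xu | x t xS tS xu xt].
  by have /orP[/eqP->|] := inS x xS xu; rewrite // !inE => /and3P[].
have /orP[/eqP xp|xP] := inS x xS xu; last exact: lu (subsetP sSA t tS) xt.
apply: contraFeq (in_set0 t) => tu; rewrite -S0 !inE tS (subsetP sSA) //=.
by rewrite -xp xt tu.
Qed.

Section DoubleStarCount.
Variables (G : sgraph) (A : {set G}) (u p : G).
Hypothesis dsA : double_star A u p.
Let P := outer A u p.
Let Q := outer A p u.

Lemma double_star_neq : u != p.
Proof.
by case: dsA => -[_ _ up] _ _ _; apply: contraTneq up => ->; rewrite adj_irr.
Qed.

Lemma outer_disjoint : [disjoint P & Q].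
Proof.
case: dsA => -[uA pA up] lu lp _; apply/pred0P => x /=.
apply/negbTE/andP => -[xP xQ].
case/eqP: double_star_neq; apply/esym/(lu x) => //.
by move: xQ; rewrite inE => /and3P[_ px _]; rewrite adj_sym.
Qed.

Lemma centres_outer_disjoint (Z : {set G}) :
  Z \subset P :|: Q -> [disjoint [set u; p] & Z].
Proof.
move=> sZ; rewrite disjoint_sym (disjointWl sZ) //; apply/pred0P => x /=.
apply/negbTE/negP; rewrite !inE => /andP[/orP[]/and3P[_ adjx xc] xup];
by move: xup adjx; rewrite (negbTE xc) ?orbF => /eqP->; rewrite adj_irr.
Qed.

Lemma double_star_card : #|A| = (#|P| + #|Q|).+2.
Proof.
case: (dsA) => -[uA pA up] _ _ sA.
have -> : A = [set u; p] :|: (P :|: Q).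
  apply/eqP; rewrite eqEsubset sA !subUset !sub1set uA pA /=.
  by apply/andP; split; apply/subsetP => x; rewrite inE => /andP[].
rewrite cardsU disjoint_setI0 ?centres_outer_disjoint // cards0 subn0.
rewrite cards2 double_star_neq; congr _.+2.
by rewrite cardsU disjoint_setI0 ?cards0 ?subn0 // outer_disjoint.
Qed.

Lemma double_star_conn_coconnE (S : {set G}) :
  S \subset A ->
  conn_coconn S = [&& [set u; p] \subset S, S :&: P != set0 & S :&: Q != set0].
Proof.
move=> sSA; case: (dsA) => -[uA pA up] lu lp sA.
have sub x : x \in S -> x \in A by apply: (subsetP sSA).
apply/idP/idP => [bS|/and3P[]].
  have SQ := conn_coconn_meets_outer dsA sSA bS.
  have SP := conn_coconn_meets_outer (double_starC dsA) sSA bS.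
  rewrite SP SQ !andbT subUset !sub1set.
  have [a /setIP[aS aP]] := set0Pn _ SP; have [b /setIP[bbS bQ]] := set0Pn _ SQ.
  rewrite (pendant_neighbour (v := a)) // => [|t /sub tA]; last exact: lu.
  by rewrite (pendant_neighbour (v := b)) // => t /sub tA; apply: lp.
rewrite subUset !sub1set => /andP[uS pS] /set0Pn[a /setIP[aS aP]].
move=> /set0Pn[b /setIP[bS bQ]].
have cases x : x \in S -> [\/ x = u, x = p, x \in P | x \in Q].
  move=> /sub/(subsetP sA); rewrite !in_setU !in_set1 -orbA.
  by case/or4P=> [/eqP|/eqP||]; [constructor 1|constructor 2|constructor 3|constructor 4].
have adjP x : x \in P -> adj u x by rewrite inE => /and3P[].
have adjQ x : x \in Q -> adj p x by rewrite inE => /and3P[].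
apply/and3P; split.
- by apply/card_gt1P; exists u, p; rewrite uS pS double_star_neq.
- apply: (@connected_induced_hub G S u) => B eqB x xS.
  have [->|->|/adjP ux|/adjQ px] // := cases x xS; first by rewrite -(eqB u).
    by rewrite -(eqB u).
  by rewrite -(eqB p x) // -(eqB u).
(* In the complement, [p] sees all of [P], [u] sees all of [Q], and [P] and [Q] are completely
   joined; the path [p], [a], [b], [u] then links everything. *)
have nPp x : x \in P -> x \in S -> @adj (compl G) x p.
  move=> xP xS; rewrite adj_complE; have := xP; rewrite inE => /and3P[_ _ ->].
  by apply: contra double_star_neq => xp; rewrite -(lu x p xP).
have nQu x : x \in Q -> x \in S -> @adj (compl G) x u.
  move=> xQ xS; rewrite adj_complE; have := xQ; rewrite inE => /and3P[_ _ ->].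
  by apply: contra double_star_neq => xu; rewrite (lp x u xQ).
have nPQ x y : x \in P -> y \in Q -> y \in S -> @adj (compl G) x y.
  move=> xP yQ yS; rewrite adj_complE; apply/andP; split.
    by apply: contraTneq xP => ->; rewrite (disjointFl outer_disjoint).
  apply/negP => /(lu x y xP (sub y yS)) yu; move: yQ.
  by rewrite !inE yu eqxx !andbF.
apply: (@connected_induced_hub (compl G) S a) => B eqB x xS.
have eqQ y : y \in Q -> y \in S -> (y \in B) = (a \in B).
  by move=> yQ yS; rewrite (eqB a y) //; apply: nPQ.
have [->|->|xP|xQ] := cases x xS; last exact: eqQ.
- by rewrite -(eqB b u bS uS (nQu b bQ bS)) eqQ.
- by rewrite -(eqB a p aS pS (nPp a aP aS)).
- by rewrite (eqB x b xS bS (nPQ x b xP bQ bS)) eqQ.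
Qed.

Lemma double_star_nb_conn_coconn :
  nb_conn_coconn A = (2 ^ #|P| - 1) * (2 ^ #|Q| - 1).
Proof.
pose N (X : {set G}) := powerset X :\ set0.
have cN X : #|N X| = 2 ^ #|X| - 1.
  by rewrite cardsDS ?sub1set ?inE ?sub0set // card_powerset cards1.
have [[uA pA up] lu lp sA] := dsA.
(* The counted sets correspond to pairs of nonempty leaf sets, one on each side; intersecting with
   [P] and [Q] inverts [f]. *)
pose f (XY : {set G} * {set G}) := [set u; p] :|: (XY.1 :|: XY.2).
have fP (X Y : {set G}) : X \subset P -> Y \subset Q -> f (X, Y) :&: P = X.
  move=> /setIidPl sX sY; rewrite /f /= setIUl [(X :|: Y) :&: _]setIUl
    (disjoint_setI0 (centres_outer_disjoint _)) ?subsetUl // sX set0U.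
  by rewrite disjoint_setI0 ?setU0 // disjoint_sym (disjointWr sY) // outer_disjoint.
have fQ (X Y : {set G}) : X \subset P -> Y \subset Q -> f (X, Y) :&: Q = Y.
  move=> sX /setIidPl sY; rewrite /f /= setIUl [(X :|: Y) :&: _]setIUl
    (disjoint_setI0 (centres_outer_disjoint _)) ?subsetUr // sY set0U.
  by rewrite disjoint_setI0 ?set0U // (disjointWl sX) // outer_disjoint.
rewrite -!cN -cardsX -[RHS](@card_in_imset _ _ f); last first.
  case=> [X Y] [X' Y']; rewrite !inE /= => /andP[/andP[_ X1] /andP[_ Y1]].
  move=> /andP[/andP[_ X2] /andP[_ Y2]] E.
  by rewrite -(fP X Y) // -{2}(fQ X Y) // E fP // fQ.
apply: eq_card => S; rewrite inE.
apply/andP/imsetP => [[sSA]|[[X Y]]].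
  rewrite double_star_conn_coconnE // => /and3P[cS SP SQ].
  exists (S :&: P, S :&: Q); first by rewrite !inE SP SQ /= !subsetIr.
  rewrite /f /= -setIUr; apply/setP => x; rewrite in_setU in_setI.
  have [xc|xc] := boolP (x \in [set u; p]); first by rewrite (subsetP cS).
  have [/(subsetP sSA)/(subsetP sA)|] //= := boolP (x \in S).
  by rewrite in_setU (negbTE xc) /= => ->.
rewrite !inE /= => /andP[/andP[X0 sX] /andP[Y0 sY]] ->.
have sFA : f (X, Y) \subset A.
  rewrite /f /= !subUset !sub1set uA pA /=.
  have sub_outer v w : outer A v w \subset A.
    by apply/subsetP => x; rewrite inE => /andP[].
  by rewrite (subset_trans sX (sub_outer _ _)) (subset_trans sY (sub_outer _ _)).
by rewrite sFA double_star_conn_coconnE // fP // fQ // X0 Y0 subsetUl.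
Qed.

End DoubleStarCount.

(** * Longest paths in an acyclic graph *)

(* The empty sequence is allowed: it is the longest path of the empty set. *)
Definition longest_path (G : sgraph) (A : {set G}) (c : seq G) : Prop :=
  let pathA c := [&& sorted (@adj G) c, uniq c & all (mem A) c] in
  pathA c /\ forall c', pathA c' -> size c' <= size c.

Lemma longest_path_exists (G : sgraph) (A : {set G}) :
  exists c, longest_path A c.
Proof.
pose pathA (c : seq G) := [&& sorted (@adj G) c, uniq c & all (mem A) c].
pose sizeA k := [exists c : k.-tuple G, pathA c].
have ex0 : exists k, sizeA k by exists 0; apply/existsP; exists [tuple].
have bound k : sizeA k -> k <= #|G|.
  by move=> /existsP[c /and3P[_ Uc _]]; rewrite -(size_tuple c) -(card_uniqP Uc) max_card.
have [k /existsP[c pc] max_k] := ex_maxnP ex0 bound.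
exists c; split=> // c' pc'; rewrite size_tuple; apply: max_k.
by apply/existsP; exists (in_tuple c').
Qed.

Section LongestPath.
Variables (G : sgraph) (A : {set G}).
Hypothesis acyclicG : acyclic G.

Lemma longest_path_rev (c : seq G) :
  longest_path A c -> longest_path A (rev c).
Proof.
case=> pc max_c; split; last by rewrite size_rev.
rewrite rev_sorted rev_uniq all_rev.
by case/and3P: pc => sc -> ->; rewrite (eq_sorted (fun x y => adj_sym y x)) sc.
Qed.

(** Such a chord would close the segment from [x] to [w] into a cycle, of length at least three
    because [y] lies in between. *)
Lemma path_no_chord (x y w : G) (s : seq G) :
  path (@adj G) x (y :: s) -> uniq [:: x, y & s] -> w \in s -> ~~ adj x w.
Proof.
move=> pth Us ws; apply/negP => xw.
case/splitPr: ws pth Us => s1 s2 pth Us.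
apply: (acyclicG (c := [:: x, y & rcons s1 w])); first by rewrite /= size_rcons.
rewrite /ucycle; apply/andP; split.
  move: pth; rewrite -cat_rcons -cat_cons cat_path => /andP[pth _].
  by rewrite /cycle rcons_path pth /= last_rcons adj_sym.
by move: Us; rewrite -cat_rcons -!cat_cons cat_uniq => /andP[].
Qed.

(** Another neighbour in [A] would either give a chord or extend the path. *)
Lemma longest_path_end (x y : G) (s : seq G) :
  longest_path A [:: x, y & s] -> {in A, forall w, adj x w -> w = y}.
Proof.
case=> /and3P[srt Us sA] max_s w wA xw.
have [//|wy] := eqVneq w y.
have wx : w != x by apply: contraTneq xw => ->; rewrite adj_irr.
have ws : w \notin s.
  by apply: contraTN xw; apply: (path_no_chord srt Us).
have /max_s : [&& sorted (@adj G) [:: w, x, y & s], uniq [:: w, x, y & s]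
    & all (mem A) [:: w, x, y & s]].
  move: srt Us sA => /= -> -> ->; rewrite !inE !negb_or wx wy ws adj_sym xw.
  by rewrite !andbT.
by rewrite /= ltnn.
Qed.

(** Replacing the first vertex [x] by [w] gives a path of the same length, hence again a longest
    one, so [w] is an end too. *)
Lemma longest_path_second (x y z : G) (s : seq G) :
  longest_path A [:: x, y, z & s] ->
  {in outer A y z & A, forall w t, adj w t -> t = y}.
Proof.
move=> long_s w t; rewrite inE => /and3P[wA yw wz] tA.
have [pth max_s] := long_s; have /and3P[srt Us sA] := pth.
apply: (@longest_path_end w y (z :: s)) => //; split=> //.
have wy : w != y by apply: contraTneq yw => ->; rewrite adj_irr.
have ws : w \notin s.
  move: srt Us => /= /andP[_ srt] /andP[_ Us].
  by apply: contraTN yw; apply: (path_no_chord srt Us).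
move: srt Us sA => /= /andP[_ ->] /andP[_ ->] /andP[_ ->].
by rewrite !inE !negb_or wz wy ws adj_sym yw wA.
Qed.

End LongestPath.

Section LongestPathCases.
Variables (G : sgraph) (A : {set G}).
Hypothesis acyclicG : acyclic G.

Lemma connected_double_star (u p : G) :
  connected (induced A) -> u \in A -> p \in A -> adj u p ->
  {in outer A u p & A, forall w t, adj w t -> t = u} ->
  {in outer A p u & A, forall w t, adj w t -> t = p} ->
  double_star A u p.
Proof.
move=> /connected_inducedP conA uA pA up lu lp; split=> //.
apply/subsetP => x xA.
apply: (conA _ _ u x) => // [a b aA bA ab|]; last by rewrite !inE eqxx.
rewrite !in_setU !in_set1 -orbA => /or4P[/eqP au|/eqP ap|aP|aQ].
- by rewrite inE bA -au ab; case: (b == p); rewrite /= ?orbT.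
- by rewrite [b \in outer A p u]inE bA -ap ab; case: (b == u); rewrite /= ?orbT.
- by rewrite (lu a b aP bA ab) eqxx.
- by rewrite (lp a b aQ bA ab) eqxx orbT.
Qed.

Lemma short_longest_path (c : seq G) :
  connected (induced A) -> 1 < #|A| -> longest_path A c -> size c < 5 ->
  exists u p, double_star A u p.
Proof.
move=> conA /card_gt1P[a [b [aA bA ab]]] long_c.
have := longest_path_rev long_c; move: long_c.
case: c => [|x [|y [|z [|w []]]]] // long_c long_rc _.
- by have := long_c.2 [:: a]; rewrite /= aA => /(_ isT).
- case/eqP: ab.
  suff eqx t : t \in A -> t = x by rewrite (eqx a) // (eqx b).
  have xA : x \in A by have := long_c.1; rewrite /= andbT.
  move=> tA; apply/set1P; move/connected_inducedP: conA => conA.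
  apply: (conA _ _ x t) (set11 x) => // d e dA eA de /set1P dx.
  have ne : d != e by apply: contraTneq de => ->; rewrite adj_irr.
  by have := long_c.2 [:: d; e]; rewrite /= dA eA de !inE ne => /(_ isT).
- have := long_c.1; rewrite /= !andbT => /and3P[xy _ /andP[xA yA]].
  exists x, y; apply: connected_double_star => // [w t|w t];
    rewrite inE => /and3P[wA xw /eqP[]].
    exact: longest_path_end long_c _ wA xw.
  exact: longest_path_end long_rc _ wA xw.
(* Three vertices: a star with centre [y]. The end [z] serves as second centre, with no leaf of its
   own. *)
- have := long_c.1; rewrite /= !andbT => /and3P[/andP[xy yz] _ /and3P[xA yA zA]].
  exists y, z; apply: connected_double_star => // [|w t].
    exact: longest_path_second long_c.
  rewrite inE => /and3P[wA xw /eqP[]].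
  exact: longest_path_end long_rc _ wA xw.
have := long_c.1; rewrite /= !andbT.
move=> /and3P[/and3P[xy yz _] _ /and4P[xA yA zA wA]].
by exists y, z; apply: connected_double_star => //;
  [apply: longest_path_second long_c|apply: longest_path_second long_rc].
Qed.

Lemma connected_setD1_pendant (v u : G) :
  {in A, forall t, adj v t -> t = u} -> connected (induced A) ->
  connected (induced (A :\ v)).
Proof.
move=> pend_v /connected_inducedP conA.
apply/connected_inducedP => B clB x y /setD1P[xv xA] /setD1P[yv yA] xB.
(* Placing [v] on the same side as its only neighbour [u] makes the cut closed in all of [A]. *)
pose B' := if u \in B then v |: B else B :\ v.
have inB' t : t != v -> (t \in B') = (t \in B).
  by rewrite /B'; case: ifP => _ tv; rewrite !inE (negbTE tv).
have vB' : (v \in B') = (u \in B) by rewrite /B'; case: ifP; rewrite !inE eqxx.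
suff clB' : {in A &, forall a b, adj a b -> a \in B' -> b \in B'}.
  by rewrite -inB' //; apply: (conA B' clB' x y) => //; rewrite inB'.
move=> a b aA bA; have [->|av] := eqVneq a v.
  move=> vb; have bv : b != v.
    by apply: contraTneq vb => ->; rewrite adj_irr.
  by rewrite vB' inB' // (pend_v b bA vb).
have [->|bv] := eqVneq b v.
  by rewrite adj_sym inB' // => va; rewrite vB' (pend_v a aA va).
by rewrite !inB' //; apply: clB; rewrite !inE ?av ?bv.
Qed.

End LongestPathCases.

(** * Removing an end of a long path *)

Lemma card_set_interval (T : finType) (B A : {set T}) :
  B \subset A ->
  #|[set S : {set T} | (B \subset S) && (S \subset A)]| <= 2 ^ (#|A| - #|B|).
Proof.
move=> sBA; rewrite -cardsDS // -card_powerset.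
apply: leq_trans (leq_imset_card (setU B) _); apply: subset_leq_card.
apply/subsetP => S; rewrite inE => /andP[sBS sSA].
apply/imsetP; exists (S :\: B); first by rewrite inE setSD.
by rewrite -[in LHS](setID S B) (setIidPr sBS).
Qed.

Section LongPath.
Variables (G : sgraph) (A : {set G}).
Hypothesis acyclicG : acyclic G.

Lemma nb_conn_coconn_setD1 (v : G) :
  nb_conn_coconn A <= nb_conn_coconn (A :\ v) +
    #|[set S : {set G} | [&& S \subset A, conn_coconn S & v \in S]]|.
Proof.
rewrite -[nb_conn_coconn A](cardsID [set S : {set G} | v \in S]) addnC leq_add //;
  apply: subset_leq_card; apply/subsetP => S; rewrite !inE.
  by rewrite subsetD1 => /andP[-> /andP[-> ->]].
by move=> /andP[/andP[-> ->] ->].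
Qed.

(** Five vertices keep the final edge [z'], [z] apart from [v], [u], [p]; reversing the path makes
    [z] a starting point. *)
Lemma longest_path_tail_edge (c : seq G) :
  longest_path A c -> 4 < size c ->
  exists v u p z z', [/\ uniq [:: v; u; p; z; z'],
    all (mem A) [:: v; u; p; z; z'],
    exists s, longest_path A [:: v, u, p & s]
    & exists s, longest_path A [:: z, z' & s]].
Proof.
move=> long_c; have := longest_path_rev long_c; have := long_c.1; move: long_c.
case: c => [|v [|u [|p s]]] //; case/lastP: s => // s z; case/lastP: s => // s z'.
move=> long_c /and3P[_ Uc cA] long_rc _.
have sub : subseq [:: v; u; p; z'; z] [:: v, u, p & rcons (rcons s z') z].
  by rewrite /= !eqxx -!cats1 -catA suffix_subseq // suffix_suffix.
exists v, u, p, z, z'; split.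
- have := subseq_uniq sub Uc; congr is_true; apply/esym/perm_uniq.
  by rewrite !perm_cons; apply/permP => a /=; rewrite addnCA.
- apply/allP => x; rewrite !inE => xin; apply: (allP cA).
  by apply: (mem_subseq sub); rewrite !inE [(x == z') || _]orbC.
- by exists (rcons (rcons s z') z).
- by move: long_rc; rewrite !rev_cons rev_rcons rev_rcons /=; eexists; eassumption.
Qed.

Lemma nb_conn_coconn_longest_path (c : seq G) :
  connected (induced A) -> longest_path A c -> 4 < size c ->
  exists v, [/\ v \in A, connected (induced (A :\ v)), 4 < #|A|
    & nb_conn_coconn A <= nb_conn_coconn (A :\ v) + (3 * 2 ^ (#|A| - 5) - 1)].
Proof.
move=> conA /longest_path_tail_edge/[apply].
case=> v [u [p [z [z' [U cA [s long_v] [s' long_z]]]]]].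
have pend_v := longest_path_end acyclicG long_v.
have pend_z := longest_path_end acyclicG long_z.
have lu := longest_path_second acyclicG long_v.
have [vA uA pA zA z'A] : [/\ v \in A, u \in A, p \in A, z \in A & z' \in A].
  by move: cA; rewrite /= andbT => /and5P[].
have [vu up] : adj v u /\ adj u p.
  by have /and3P[/= /and3P[]] := long_v.1.
have card5 : #|[set v; u; p; z; z']| = 5.
  by rewrite -[RHS]/(size [:: v; u; p; z; z']) -(card_uniqP U); apply: eq_card => x;
     rewrite !inE !orbA.
have sub5 : [set v; u; p; z; z'] \subset A.
  by rewrite !subUset !sub1set vA uA pA zA.
have A5 : 4 < #|A| by rewrite -card5 subset_leq_card.
exists v; split=> //; first exact: connected_setD1_pendant pend_v conA.
apply: leq_trans (nb_conn_coconn_setD1 v) _; rewrite leq_add2l.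
have [uv pv pu] : [/\ u != v, p != v & p != u].
  move: U; rewrite /= !inE !negb_or => /and3P[/andP[vu' /andP[vp _]] /andP[up' _] _].
  by rewrite ![_ == v]eq_sym vu' vp eq_sym.
have zI : z \notin [set v; u; p].
  move: U; rewrite /= !inE !negb_or => /and4P[/and4P[_ _ vz _] /and3P[_ uz _] /andP[pz _] _].
  by rewrite !(eq_sym z) vz uz.
have card3 : #|[set v; u; p]| = 3.
  by rewrite -setUA cardsU1 !inE negb_or ![v == _]eq_sym uv pv cards2 eq_sym pu.
(* Counted sets through [v] also contain [u] and [p]. Those avoiding [z] lie in [I3], of size at
   most 2 ^ (#|A| - 4); those containing [z], and hence [z'], lie in [I5], of size at most 2 ^ (#|A|
   - 5). *)
pose I3 := [set S : {set G} | ([set v; u; p] \subset S) && (S \subset A :\ z)].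
pose I5 := [set S : {set G} | ([set v; u; p; z; z'] \subset S) && (S \subset A)].
have sub3 : [set v; u; p] \subset A :\ z.
  by rewrite subsetD1 zI !subUset !sub1set vA uA pA.
apply: (@leq_trans #|I5 :|: (I3 :\ [set v; u; p])|).
  apply: subset_leq_card; apply/subsetP => S; rewrite inE => /and3P[sSA bS vS].
  have inA x : x \in S -> x \in A by apply: (subsetP sSA).
  have uS : u \in S by apply: (pendant_neighbour (v := v)) => // t /inA; apply: pend_v.
  have luS : {in S &, forall x t, x != u -> adj u x -> x != p -> adj x t -> t = u}.
    by move=> x t xS tS xu ux xp; apply: (lu x t) (inA t tS); rewrite inE inA ?ux.
  have pS : p \in S.
    apply: contraTT (bS) => pNS.
    have npS x : x \in S -> x != p by apply: contraTneq => ->.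
    (* Without [p], every neighbour of [u] in [S] is a leaf, so the closed neighbourhood of [u]
       absorbs all of [S], which is then a star. *)
    have dom x : x \in S -> x \in u |: [set y | adj u y].
      move=> xS; case/and3P: (bS) => _ /connected_inducedP conS _.
      apply: (conS _ _ u x uS xS); last by rewrite setU11.
      move=> a b aS bbS ab; rewrite !inE => /predU1P[<-|ua]; first by rewrite ab orbT.
      have [au|au] := eqVneq a u; first by rewrite -au ab orbT.
      by rewrite (luS a b aS bbS au ua (npS a aS) ab) eqxx.
    have domS x : x \in S -> x != u -> adj u x.
      by move=> /dom; rewrite !inE => /predU1P[->|//]; rewrite eqxx.
    apply: (@star_not_conn_coconn _ _ u) => // x t xS tS xu.
    exact: luS xS tS xu (domS x xS xu) (npS x xS).
  have sub3S : [set v; u; p] \subset S by rewrite !subUset !sub1set vS uS.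
  rewrite /I5 /I3 !inE sub3S sSA; have [zS|zNS] := boolP (z \in S).
    have z'S : z' \in S.
      by apply: (pendant_neighbour (v := z)) => // t /inA; apply: pend_z.
    by rewrite !subUset !sub1set vS uS pS zS z'S.
  (* The set {[v], [u], [p]} is itself a star at [u]; excluding it gives the - 1 in the estimate. *)
  rewrite subsetD1 sSA zNS /= !andbT; apply/orP; right; apply: contraTneq bS => ->.
  apply: (@star_not_conn_coconn _ _ u) => [x|x t].
    by rewrite !inE -orbA => /or3P[]/eqP->; rewrite ?eqxx // adj_sym.
  rewrite !inE -!orbA => /or3P[]/eqP-> tI; rewrite ?eqxx // => _.
    by apply: pend_v; case/or3P: tI => /eqP->.
  case/or3P: tI => /eqP-> //; last by rewrite adj_irr.
  by rewrite adj_sym => /(pend_v p pA) /eqP; rewrite (negbTE pu).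
rewrite cardsU (leq_trans (leq_subr _ _)) //.
have c5 : #|I5| <= 2 ^ (#|A| - 5) by rewrite -card5; apply: card_set_interval.
have c3 : #|I3| <= 2 * 2 ^ (#|A| - 5).
  apply: leq_trans (card_set_interval sub3) _.
  have cardA : #|A| = #|A :\ z|.+1 by rewrite (cardsD1 z) zA.
  rewrite -expnS leq_exp2l // card3 cardA.
  by move: A5; rewrite cardA; clear; move: #|A :\ z| => k; lia.
have := cardsD1 [set v; u; p] I3; rewrite [_ \in I3]inE subxx sub3 /=.
move: c5 c3; move: #|I3| #|I5| (#|I3 :\ _|) (2 ^ _) => a b d e; clear; lia.
Qed.

End LongPath.

(** * Double stars up to isomorphism *)

Section Isomorphism.
Variable G : sgraph.

Lemma double_star_isomorphic (u p : G) :
  double_star [set: G] u p ->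
  isomorphic G (dstar #|outer [set: G] u p| #|outer [set: G] p u|).
Proof.
move=> ds; set P := outer _ u p; set Q := outer _ p u.
have [[_ _ up] lu lp _] := ds.
pose h (x : dstar #|P| #|Q|) : G := match x with
  | inl None => u | inl (Some i) => enum_val i
  | inr None => p | inr (Some j) => enum_val j end.
have PQ x : x \in P -> x \notin Q.
  by move=> xP; rewrite (disjointFr (outer_disjoint ds) xP).
have Pu x : x \in P -> [/\ adj u x, x != p & x != u].
  rewrite !inE /= => /andP[ux ->]; split=> //.
  by apply: contraTneq ux => ->; rewrite adj_irr.
have Qp x : x \in Q -> [/\ adj p x, x != u & x != p].
  rewrite !inE /= => /andP[ux ->]; split=> //.
  by apply: contraTneq ux => ->; rewrite adj_irr.
have eP (i : 'I_#|P|) : enum_val i \in P by apply: enum_valP.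
have eQ (i : 'I_#|Q|) : enum_val i \in Q by apply: enum_valP.
have hadj x y : adj (h x) (h y) = adj x y.
  have nu w t : w \in P -> t != u -> adj w t = false.
    by move=> wP; apply: contraNF => wt; apply/eqP/(lu w) => //; rewrite inE.
  have np w t : w \in Q -> t != p -> adj w t = false.
    by move=> wQ; apply: contraNF => wt; apply/eqP/(lp w) => //; rewrite inE.
  case: x y => [[i|]|[i|]] [[j|]|[j|]] /=; rewrite ?adj_irr //.
  - by apply: nu => //; case: (Pu _ (eP j)).
  - by rewrite adj_sym; case: (Pu _ (eP i)).
  - by apply: nu => //; case: (Qp _ (eQ j)).
  - by apply: nu => //; rewrite eq_sym (double_star_neq ds).
  - by case: (Pu _ (eP j)).
  - by rewrite adj_sym; apply: np => //; rewrite (double_star_neq ds).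
  - by apply: np => //; case: (Pu _ (eP j)).
  - by apply: np => //; rewrite (double_star_neq ds).
  - by apply: np => //; case: (Qp _ (eQ j)).
  - by rewrite adj_sym; case: (Qp _ (eQ i)).
  - by rewrite adj_sym; apply: nu => //; rewrite eq_sym (double_star_neq ds).
  - by rewrite adj_sym.
  - by case: (Qp _ (eQ j)).
have hinj : injective h.
  have nup := double_star_neq ds.
  case=> [[i|]|[i|]] [[j|]|[j|]] //=.
  - by move/enum_val_inj->.
  - by move=> E; have [_ _] := Pu _ (eP i); rewrite E eqxx.
  - by move=> E; have := PQ _ (eP i); rewrite E eQ.
  - by move=> E; have [_] := Pu _ (eP i); rewrite E eqxx.
  - by move=> E; have [_ _] := Pu _ (eP j); rewrite -E eqxx.
  - by move=> E; have [_] := Qp _ (eQ j); rewrite -E eqxx.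
  - by move=> E; rewrite E eqxx in nup.
  - by move=> E; have := PQ _ (eP j); rewrite -E eQ.
  - by move=> E; have [_] := Qp _ (eQ i); rewrite E eqxx.
  - by move/enum_val_inj->.
  - by move=> E; have [_ _] := Qp _ (eQ i); rewrite E eqxx.
  - by move=> E; have [_] := Pu _ (eP j); rewrite -E eqxx.
  - by move=> E; rewrite E eqxx in nup.
  - by move=> E; have [_ _] := Qp _ (eQ j); rewrite -E eqxx.
(* Equal cardinalities make the injection [h] bijective, so no surjectivity argument is required. *)
have cardG : #|G| <= #|dstar #|P| #|Q| |.
  by rewrite -cardsT (double_star_card ds) card_sum !card_option !card_ord addSn addnS.
have [f hK fK] := inj_card_bij hinj cardG.
exists f; first by exists h.
by move=> x y; rewrite -hadj !fK.
Qed.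

(** Besides the equality case, this serves, with the identity map, to exhibit [D n] itself as a
    double star and so to compute its count. *)
Lemma isomorphic_double_star (s t : nat) :
  isomorphic G (dstar s t) ->
  exists u p : G, [/\ double_star [set: G] u p,
    #|outer [set: G] u p| = s & #|outer [set: G] p u| = t].
Proof.
case=> f [h fK hK] fadj; have hI := can_inj hK.
pose u := h (inl None); pose p := h (inr None).
have adjh x y : adj (h x) (h y) = adj x y by rewrite -fadj !hK.
have P_E : outer [set: G] u p = [set h (inl (Some i)) | i : 'I_s].
  apply/setP => x; rewrite -[x]fK.
  case: (f x) => [[i|]|[i|]]; rewrite !inE adjh (inj_eq hI) /=;
    try by apply/esym/negbTE/imsetP => -[j _ /hI].
  by apply/esym/imsetP; exists i.
have Q_E : outer [set: G] p u = [set h (inr (Some i)) | i : 'I_t].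
  apply/setP => x; rewrite -[x]fK.
  case: (f x) => [[i|]|[i|]]; rewrite !inE adjh (inj_eq hI) /=;
    try by apply/esym/negbTE/imsetP => -[j _ /hI].
  by apply/esym/imsetP; exists i.
exists u, p; split.
- split; first by rewrite !inE adjh.
  + move=> w x; rewrite P_E => /imsetP[i _ ->] _; rewrite -[x]fK adjh.
    by case: (f x) => [[]|[]].
  + move=> w x; rewrite Q_E => /imsetP[i _ ->] _; rewrite -[x]fK adjh.
    by case: (f x) => [[]|[]].
  apply/subsetP => x _; rewrite -[x]fK !inE !adjh !(inj_eq hI).
  by case: (f x) => [[i|]|[i|]].
- by rewrite P_E card_imset ?card_ord // => i j /hI[].
- by rewrite Q_E card_imset ?card_ord // => i j /hI[].
Qed.

End Isomorphism.

(** * Arithmetic of the bound *)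

Definition dstar_bound (n : nat) : nat :=
  (2 ^ uphalf (n - 2) - 1) * (2 ^ (n - 2)./2 - 1).

Lemma balanced_powers (s t : nat) :
  (2 ^ s - 1) * (2 ^ t - 1) <= dstar_bound (s + t).+2
    ?= iff ((s == uphalf (s + t)) && (t == (s + t)./2)) ||
           ((t == uphalf (s + t)) && (s == (s + t)./2)).
Proof.
(* Writing s = h' + d and h = t + d, the claim reads
   2 ^ h' + 2 ^ (t + d) <= 2 ^ (h' + d) + 2 ^ t. *)
wlog le_ts : s t / t <= s.
  move=> IH; have [/IH//|/ltnW/IH] := leqP t s.
  by rewrite addnC mulnC orbC.
rewrite /dstar_bound !subSS subn0.
set h := (s + t)./2; set h' := uphalf (s + t).
have hh : h' + h = s + t.
  by have := odd_double_half (s + t); rewrite /h' uphalf_half -/h; lia.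
have le_h : h <= h' by rewrite /h' uphalf_half leq_addl.
have le_h1 : h' <= h.+1
  by rewrite /h' uphalf_half -add1n leq_add2r; case: odd.
have [d dE] : exists d, h = t + d by exists (h - t); lia.
have sE : s = h' + d by lia.
(* Since [t <= s] and [h <= h'], the swapped split forces [h = h']; both alternatives thus amount to
   [d = 0]. *)
have E : ((s == h') && (t == h)) || ((t == h') && (s == h)) = (d == 0).
  by apply/idP/idP; lia.
rewrite E {E}sE dE; move: le_h; rewrite dE; clear.
case: d => [|d] le_h; first by rewrite !addn0; apply: leqif_refl.
apply/leqifP; rewrite /=.
have lt_t : 2 ^ t < 2 ^ h' by rewrite ltn_exp2l //; lia.
have t0 : 0 < 2 ^ t by rewrite expn_gt0.
have d2 : 1 < 2 ^ d.+1 by rewrite -{1}(expn0 2) ltn_exp2l.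
(* The right side exceeds the left by (b - a) * (c - 1). *)
rewrite !expnD; move: (2 ^ t) (2 ^ h') (2 ^ d.+1) lt_t t0 d2 => a b c.
clear; nia.
Qed.

(** Here [k] stands for #|A| - 5. The bound grows by 2 ^ (k + 2) - 2 ^ (k./2 + 1), so the claim is 2
    ^ (k./2 + 1) <= 2 ^ k + 1, which is an equality only at [k = 0]. *)
Lemma dstar_bound_step (k : nat) :
  dstar_bound (k + 4) + (3 * 2 ^ k - 1) <= dstar_bound (k + 5) ?= iff (k == 0).
Proof.
rewrite /dstar_bound; have -> : k + 4 - 2 = k.+2 by lia.
have -> : k + 5 - 2 = k.+3 by lia.
case: k => [|k]; first by apply/leqifP.
apply/leqifP => /=.
have : 2 ^ k./2.+2 <= 2 ^ k.+2.
  by rewrite leq_exp2l // !ltnS leq_half_double -addnn leqW // leq_addr.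
have : 2 ^ k./2.+2 * 2 ^ (uphalf k).+1 = 2 ^ k.+3.
  by rewrite -expnD uphalf_half; congr (2 ^ _); have := odd_double_half k; lia.
rewrite !expnS; have : 0 < 2 ^ k by rewrite expn_gt0.
have : 0 < 2 ^ k./2 by rewrite expn_gt0.
have : 0 < 2 ^ uphalf k by rewrite expn_gt0.
move: (2 ^ k) (2 ^ k./2) (2 ^ uphalf k) => a b d; nia.
Qed.

(** * The upper bound and its equality case *)

(** Kept apart from the induction because the bound and the equality case both branch on it. *)
Lemma nb_conn_coconn_dichotomy (G : sgraph) (A : {set G}) : acyclic G ->
  connected (induced A) -> 1 < #|A| ->
  (exists u p, double_star A u p) \/
  (4 < #|A| /\ exists v, [/\ v \in A, connected (induced (A :\ v))
    & nb_conn_coconn A <= nb_conn_coconn (A :\ v) + (3 * 2 ^ (#|A| - 5) - 1)]).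
Proof.
move=> acG conA A2; have [c long_c] := longest_path_exists A.
have [c4|c4] := leqP 5 (size c); last by left; apply: short_longest_path long_c _.
right; have [v [vA conAv A5 le_v]] := nb_conn_coconn_longest_path acG conA long_c c4.
by split=> //; exists v.
Qed.

Lemma nb_conn_coconn_upper (G : sgraph) (A : {set G}) : acyclic G ->
  connected (induced A) -> 1 < #|A| ->
  nb_conn_coconn A <= dstar_bound #|A|.
Proof.
move=> acG; have [k] := ubnP #|A|; elim: k A => // k IHk A leAk conA A2.
have [[u [p ds]]|[A5 [v [vA conAv le_v]]]] := nb_conn_coconn_dichotomy acG conA A2.
  rewrite (double_star_nb_conn_coconn ds) (double_star_card ds).
  exact: (balanced_powers _ _).1.
have cardA : #|A| = #|A :\ v|.+1 by rewrite (cardsD1 v) vA.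
have IH : nb_conn_coconn (A :\ v) <= dstar_bound #|A :\ v| by apply: IHk => //; lia.
apply: leq_trans le_v _; apply: leq_trans (leq_add IH (leqnn _)) _.
have [stp _] := dstar_bound_step (#|A| - 5).
have E5 : #|A| - 5 + 5 = #|A| by lia.
have E4 : #|A| - 5 + 4 = #|A :\ v| by lia.
by rewrite E5 E4 in stp.
Qed.

Lemma connected_induced_setT (G : sgraph) :
  connected G -> connected (induced [set: G]).
Proof.
move=> conG; apply/connected_inducedP => B clB x y _ _ xB.
have [s pth ->] := connectP (forallP (forallP conG x) y).
elim: s x xB pth => //= w s IHs x xB /andP[xw]; apply: IHs.
by apply: clB xw xB; rewrite inE.
Qed.

(** For a double star, equality in [balanced_powers] fixes the leaf numbers up to exchanging the
    centres. Otherwise deleting [v] and bounding the rest gives a strict inequality. *)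
Lemma nb_conn_coconn_eq_isomorphic (n : nat) (T : sgraph) :
  is_tree T -> #|T| = n -> 5 < n ->
  nb_conn_coconn [set: T] = dstar_bound n <-> isomorphic T (D n).
Proof.
move=> [_ conT acT] cardT n5; split; last first.
  by case/isomorphic_double_star=> u [p [/double_star_nb_conn_coconn-> -> ->]].
have conA := connected_induced_setT conT.
have A2 : 1 < #|[set: T]| by rewrite cardsT cardT; lia.
have [[u [p ds]] eqT|[_ [v [_ conAv le_v]]]] := nb_conn_coconn_dichotomy acT conA A2.
  have := double_star_card ds; rewrite cardsT cardT => nE.
  have [_] := balanced_powers #|outer [set: T] u p| #|outer [set: T] p u|.
  rewrite -(double_star_nb_conn_coconn ds) eqT -nE eqxx.
  have -> : #|outer [set: T] u p| + #|outer [set: T] p u| = n - 2 by lia.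
  move=> /esym/orP[]/andP[/eqP E1 /eqP E2].
    by have := double_star_isomorphic ds; rewrite E1 E2.
  by have := double_star_isomorphic (double_starC ds); rewrite E1 E2.
have cardA : n = #|[set: T] :\ v|.+1 by rewrite -cardT -cardsT (cardsD1 v) inE.
move=> eqT; move: le_v; rewrite eqT cardsT cardT leqNgt => /negP[].
have le_v : nb_conn_coconn ([set: T] :\ v) <= dstar_bound #|[set: T] :\ v|.
  by apply: nb_conn_coconn_upper => //; lia.
apply: leq_ltn_trans (leq_add le_v (leqnn _)) _.
(* This is where [5 < n] enters: [n - 5] is nonzero, so the step is strict. *)
have := ltn_leqif (dstar_bound_step (n - 5)).
have -> : n - 5 + 5 = n by lia.
have -> : n - 5 + 4 = #|[set: T] :\ v| by lia.
by move->; lia.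
Qed.

(* The subtractions on nat below never truncate, since n > 5. *)
Theorem theorem4 (n : nat) (T : sgraph) (tree_T : is_tree T)
    (order_T : #|T| = n) (n_gt5 : 5 < n) :
  [/\ eta T + eta (compl T) <= eta (D n) + eta (compl (D n)),
      eta (D n) + eta (compl (D n))
        = 5 * 2 ^ (n - 2) - 2 ^ uphalf (n - 2) - 2 ^ (n - 2)./2 + n
    & eta T + eta (compl T) = eta (D n) + eta (compl (D n))
        <-> isomorphic T (D n)].
Proof.
have cardD : #|D n| = n.
  rewrite card_sum !card_option !card_ord addSn addnS uphalf_half.
  by have := odd_double_half (n - 2); lia.
have countD : nb_conn_coconn [set: D n] = dstar_bound n.
  have [|u [p [/double_star_nb_conn_coconn-> -> ->]]] // :=
    @isomorphic_double_star (D n) (uphalf (n - 2)) (n - 2)./2.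
  by exists id => //; exists id.
rewrite !eta_add_compl cardD order_T countD.
split.
- have [_ conT acT] := tree_T; rewrite leq_add2l -order_T -cardsT.
  apply: nb_conn_coconn_upper => //; first exact: connected_induced_setT.
  by rewrite cardsT order_T (ltn_trans _ n_gt5).
(* Expanding the product gives 2 ^ (n - 2) minus the two half powers plus 1; with 2 ^ n = 4 * 2 ^ (n
   - 2) this yields the factor 5, and the 1 cancels the - 1 for the empty set. *)
- rewrite /dstar_bound; have nE : n = (n - 2).+2 by lia.
  have : 2 ^ uphalf (n - 2) * 2 ^ (n - 2)./2 = 2 ^ (n - 2).
    by rewrite -expnD; congr (2 ^ _); have := odd_double_half (n - 2);
       rewrite uphalf_half; lia.
  have : 2 ^ n = 4 * 2 ^ (n - 2) by rewrite {1}nE !expnS mulnA.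
  have : 0 < 2 ^ uphalf (n - 2) by rewrite expn_gt0.
  have : 0 < 2 ^ (n - 2)./2 by rewrite expn_gt0.
  move: (2 ^ uphalf _) (2 ^ _./2) (2 ^ n) (2 ^ (n - 2)) => a b c d; nia.
split=> [/addnI|]; last by move/nb_conn_coconn_eq_isomorphic->.
by move/nb_conn_coconn_eq_isomorphic; apply.
Qed.
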